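(* Let $n,k\ge1$. A square Hermitian orthogonal design $\mathcal{O}_x$ of size $[n,n,2k-1]$ exists if and only if $2^{k-1}\mid n$. Moreover, for any such $\mathcal{O}_x$ there exist $U,V\in U_n(\mathbb{C})$ such that $$\mathcal{O}_x=U\,\mathrm{diag}(\mathcal{H}_{2k-1},\ldots,\mathcal{H}_{2k-1})\,V=U\big(I_{n/2^{k-1}}\otimes\mathcal{H}_{2k-1}\big)V.$$
   Context: Let $x_1,x_2,\ldots$ be formal real indeterminates. A Hermitian orthogonal design (HOD) of size $[p,n,m]$ is a $p\times n$ matrix $\mathcal{O}_x$ whose entries are complex linear combinations of $x_1,\ldots,x_m$ such that $\mathcal{O}_x^H\mathcal{O}_x=(x_1^2+\cdots+x_m^2)I_n$; it is square if $p=n$. Define $\mathcal{H}_2=(x_1+x_2\sqrt{-1})$ and for $k>1$ the $2^{k-1}\times2^{k-1}$ matrix $$\mathcal{H}_{2k}=\begin{pmatrix}\mathcal{H}_{2k-2} & (x_{2k-1}+x_{2k}\sqrt{-1})I_{2^{k-2}}\\ -(x_{2k-1}-x_{2k}\sqrt{-1})I_{2^{k-2}} & \mathcal{H}_{2k-2}^H\end{pmatrix},$$ where $^H$ is conjugate transpose with the $x_i$ treated as real. Let $\mathcal{H}_{2k-1}$ be the matrix obtained from $\mathcal{H}_{2k}$ by setting $x_{2k}=0$. $U_n(\mathbb{C})$ is the group of $n\times n$ unitary matrices. *)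

(* Defs.v *)
From HB Require Import structures.
From mathcomp Require Import all_boot all_algebra reals.
From mathcomp.real_closed Require Import complex.
From mathcomp Require Import sesquilinear spectral.
Set Implicit Arguments. Unset Strict Implicit. Unset Printing Implicit Defensive.
Import GRing.Theory Num.Theory.
Local Open Scope ring_scope.
Local Open Scope sesquilinear_scope.

(* Complex numbers are R[i] for R : realType (the real numbers).
   The formal real indeterminates x_1, x_2, ... are 0-indexed: x_(i+1) is [x i].
   Conjugate transpose is spectral's  A ^t*  (:= map conjC then transpose). *)

(* Complex linear combination  O_x = \sum_i x_i A_i  of coefficient matrices. *)
Definition mxO (R : realType) (m p n : nat) (A : 'I_m -> 'M[R[i]]_(p, n))
    (x : 'I_m -> R) : 'M[R[i]]_(p, n) :=
  \sum_(j < m) (real_complex R (x j)) *: A j.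

(* Hermitian orthogonal design of size [p,n,m]: O_x^H O_x = (x_1^2+...+x_m^2) I_n,
   as an identity in the real indeterminates x (equivalently: for all real x). *)
Definition is_HOD (R : realType) (m p n : nat) (A : 'I_m -> 'M[R[i]]_(p, n)) : Prop :=
  forall x : 'I_m -> R,
    (mxO A x) ^t* *m mxO A x = (real_complex R (\sum_(j < m) x j ^+ 2))%:M.

Definition pow2S_eq (j : nat) : (2 ^ j + 2 ^ j = 2 ^ j.+1)%N :=
  etrans (addnn _) (esym (etrans (expnS 2 j) (mul2n _))).

(* Hrec x j = H_{2(j+1)} evaluated at x (size 2^j). *)
Fixpoint Hrec (R : realType) (x : nat -> R) (j : nat) : 'M[R[i]]_(2 ^ j) :=
  match j return 'M[R[i]]_(2 ^ j) with
  | 0 => (Complex (x 0%N) (x 1%N))%:M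
  | j'.+1 =>
      castmx (pow2S_eq j', pow2S_eq j')
        (block_mx (Hrec x j')
                  ((Complex (x j'.*2.+2) (x j'.*2.+3))%:M)
                  (- (Complex (x j'.*2.+2) (- x j'.*2.+3))%:M)
                  ((Hrec x j') ^t*))
  end.

(* H_{2k} (for k >= 1), of size 2^(k-1). *)
Definition Heven (R : realType) (k : nat) (x : nat -> R) : 'M[R[i]]_(2 ^ k.-1) :=
  Hrec x k.-1.

(* H_{2k-1}: H_{2k} with x_{2k} (0-indexed: x (2k-1)) set to 0. *)
Definition Hodd (R : realType) (k : nat) (x : nat -> R) : 'M[R[i]]_(2 ^ k.-1) :=
  Heven k (fun j => if j == k.*2.-1 then 0 else x j).

(* Extend x : 'I_m -> R to all indeterminates (zero beyond m). *)
Definition ext (R : realType) (m : nat) (x : 'I_m -> R) : nat -> R :=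
  fun j => if @insub nat (fun j => j < m)%N 'I_m j is Some o then x o else 0.

(* Main.v *)
Require Import Defs.
From HB Require Import structures.
From mathcomp Require Import all_boot all_algebra reals.
From mathcomp.real_closed Require Import complex.
From mathcomp Require Import sesquilinear spectral.
Set Implicit Arguments. Unset Strict Implicit. Unset Printing Implicit Defensive.
Import GRing.Theory Num.Theory.
Local Open Scope ring_scope.
Local Open Scope sesquilinear_scope.

(** Write [O_x = \sum_i x_i A_i]; the design identity says that the [A_i] are
    unitary and [A_i^H A_l = - A_l^H A_i] for [i != l].  An odd family
    [A_0, ..., A_(2j)] always extends by one matrix so that the alternating
    product [A_0^H A_1 A_2^H A_3 ... A_(2j)^H A_(2j+1)] is a prescribed scalar;
    this normalisation selects one of the two irreducible Clifford modules and
    makes the even normal form [I (x) H_(2j+2)] unique.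

    The even case goes by induction on [j].  After multiplying by the adjoint
    of the next to last matrix, that matrix is [1], the last one is a skew
    unitary [G], and all the others are skew and anticommute with [G].  Hence
    they exchange the two eigenspaces of [G], which have the same dimension; in
    a basis adapted to these eigenspaces they become [0, C_i; - C_i^H, 0], where
    the [C_i] form a normalised design with two variables less.  This is, up to
    a swap of columns and a sign, the recursion defining [H_(2j+4)]. *)

(** * Algebra of the conjugate transpose *)

Section Adjoint.
Variable C : numClosedFieldType.

Lemma trmxC_mul m n p (A : 'M[C]_(m, n)) (B : 'M[C]_(n, p)) :
  (A *m B) ^t* = B ^t* *m A ^t*.
Proof. by rewrite trmx_mul map_mxM. Qed.

Lemma trmxCD m n (A B : 'M[C]_(m, n)) : (A + B) ^t* = A ^t* + B ^t*.
Proof. by rewrite linearD map_mxD. Qed.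

Lemma trmxCN m n (A : 'M[C]_(m, n)) : (- A) ^t* = - A ^t*.
Proof. by rewrite linearN map_mxN. Qed.

Lemma trmxCZ m n a (A : 'M[C]_(m, n)) : (a *: A) ^t* = a^* *: A ^t*.
Proof. by rewrite linearZ map_mxZ. Qed.

Lemma trmxC_scalar n (a : C) : (a%:M : 'M_n) ^t* = (a^*)%:M.
Proof. by rewrite tr_scalar_mx map_scalar_mx. Qed.

Lemma trmxC1 n : (1%:M : 'M[C]_n) ^t* = 1%:M.
Proof. by rewrite trmxC_scalar rmorph1. Qed.

Lemma trmxC_sum m n (I : Type) (r : seq I) (P : pred I) (F : I -> 'M[C]_(m, n)) :
  (\sum_(i <- r | P i) F i) ^t* = \sum_(i <- r | P i) (F i) ^t*.
Proof. by rewrite raddf_sum map_mx_sum. Qed.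

Lemma trmxC_block m1 m2 n1 n2 (a : 'M[C]_(m1, n1)) (b : 'M[C]_(m1, n2))
    (c : 'M[C]_(m2, n1)) (d : 'M[C]_(m2, n2)) :
  (block_mx a b c d) ^t* = block_mx (a ^t*) (c ^t*) (b ^t*) (d ^t*).
Proof. by rewrite tr_block_mx map_block_mx. Qed.

Lemma trmxC_cast m n m' n' (eq_mn : (m = m') * (n = n')) (A : 'M[C]_(m, n)) :
  (castmx eq_mn A) ^t* = castmx (eq_mn.2, eq_mn.1) (A ^t*).
Proof. by case: eq_mn => e1 e2; case: _ / e1; case: _ / e2; rewrite !castmx_id. Qed.

Lemma eqNmx m n (A : 'M[C]_(m, n)) : A = - A -> A = 0.
Proof.
move=> h; have : 2%:R *: A = 0 by rewrite scaler_nat mulr2n {2}h subrr.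
by move/eqP; rewrite scaler_eq0 pnatr_eq0 /= => /eqP.
Qed.

End Adjoint.

(** * Clifford relations and the alternating product *)

Section Clifford.
Variables (C : numClosedFieldType) (n : nat).
Implicit Types (A B : nat -> 'M[C]_n) (X U V : 'M[C]_n).

(** Families are indexed by [nat] and constrained only below [m], so that truncating or extending
    one does not change its type. *)
Definition hod_family m A :=
  (forall i, (i < m)%N -> A i ^t* *m A i = 1%:M) /\
  (forall i l, (i < m)%N -> (l < m)%N -> i != l ->
     A i ^t* *m A l = - (A l ^t* *m A i)).

Fixpoint pair_prod A j : 'M[C]_n :=
  if j is j'.+1 then pair_prod A j' *m (A j'.*2 ^t* *m A j'.*2.+1) else 1%:M.

Lemma eq_pair_prod j A B : (forall i, (i < j.*2)%N -> A i = B i) ->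
  pair_prod A j = pair_prod B j.
Proof.
elim: j => [|j IH] //= AB; rewrite IH.
  by rewrite !AB // doubleS ltnS // leqW.
by move=> i ij; apply: AB; apply: ltn_trans ij _; rewrite doubleS.
Qed.

Lemma hod_family_equiv m A U V :
  U ^t* *m U = 1%:M -> V ^t* *m V = 1%:M ->
  hod_family m A -> hod_family m (fun i => U *m A i *m V).
Proof.
move=> hU hV [h1 h2].
have E i l : (U *m A i *m V) ^t* *m (U *m A l *m V)
             = V ^t* *m (A i ^t* *m A l) *m V.
  by rewrite !trmxC_mul !mulmxA -[_ *m _ *m U]mulmxA hU mulmx1.
split=> [i im|i l im lm il]; rewrite !E.
  by rewrite h1 // mulmx1.
by rewrite h2 // mulmxN mulNmx.
Qed.

(** Inside the product all factors [U] and all inner factors [V] cancel. In particular, a scalar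
    alternating product is invariant under equivalence of designs. *)
Lemma pair_prod_equiv j A U V :
  U ^t* *m U = 1%:M -> V ^t* *m V = 1%:M ->
  pair_prod (fun i => U *m A i *m V) j = V ^t* *m pair_prod A j *m V.
Proof.
move=> hU hV; elim: j => [|j IH] /=; first by rewrite mulmx1.
rewrite IH !trmxC_mul !mulmxA -[_ *m _ *m U]mulmxA hU mulmx1.
by rewrite -[_ *m _ *m V ^t*]mulmxA (mulmx1C hV) mulmx1.
Qed.

Lemma hod_family_adj m B l : hod_family m B -> (l < m)%N -> B l = 1%:M ->
  forall i, (i < m)%N -> i != l -> B i ^t* = - B i.
Proof.
move=> [_ h2] lm Bl i im il; have := h2 i l im lm il.
by rewrite Bl mulmx1 trmxC1 mul1mx.
Qed.

Lemma hod_family_anticomm m B l : hod_family m B -> (l < m)%N -> B l = 1%:M ->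
  forall i i', (i < m)%N -> (i' < m)%N -> i != l -> i' != l -> i != i' ->
  B i *m B i' = - (B i' *m B i).
Proof.
move=> hB lm Bl i i' im i'm il i'l ii'; have := hB.2 i i' im i'm ii'.
by rewrite !(hod_family_adj hB lm Bl) // !mulNmx => /oppr_inj.
Qed.

Lemma anticomm_mul_comm X Y Z :
  X *m Z = - (Z *m X) -> Y *m Z = - (Z *m Y) -> X *m Y *m Z = Z *m (X *m Y).
Proof. by move=> hX hY; rewrite -mulmxA hY mulmxN !mulmxA hX mulNmx opprK. Qed.

(** Moving [X] across an even number of anticommuting factors produces an even number of signs. *)
Lemma pair_prod_comm j B X :
  (forall i, (i < j.*2)%N -> B i ^t* = - B i) ->
  (forall i, (i < j.*2)%N -> B i *m X = - (X *m B i)) ->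
  pair_prod B j *m X = X *m pair_prod B j.
Proof.
elim: j => [|j IH] ha hX /=; first by rewrite mul1mx mulmx1.
have lt1 : (j.*2 < j.+1.*2)%N by rewrite doubleS.
have lt2 : (j.*2.+1 < j.+1.*2)%N by rewrite doubleS.
have IH' : pair_prod B j *m X = X *m pair_prod B j.
  by apply: IH => i ij; [apply: ha | apply: hX]; apply: ltn_trans ij _.
rewrite -mulmxA [_ *m X]anticomm_mul_comm ?hX //; first by rewrite !mulmxA IH'.
by rewrite ha // mulNmx hX // mulmxN.
Qed.

(** Among the [2j] factors, [B i] commutes with itself and anticommutes with the others, which are
    odd in number. *)
Lemma pair_prod_anticomm j B :
  (forall i, (i < j.*2)%N -> B i ^t* = - B i) ->
  (forall i l, (i < j.*2)%N -> (l < j.*2)%N -> i != l ->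
     B i *m B l = - (B l *m B i)) ->
  forall i, (i < j.*2)%N -> pair_prod B j *m B i = - (B i *m pair_prod B j).
Proof.
elim: j => [|j IH] // ha hc i /=.
have lt1 : (j.*2 < j.+1.*2)%N by rewrite doubleS.
have lt2 : (j.*2.+1 < j.+1.*2)%N by rewrite doubleS.
have ltS i' : (i' < j.*2)%N -> (i' < j.+1.*2)%N by move/ltn_trans; apply.
have hcomm l : (l >= j.*2)%N -> (l < j.+1.*2)%N ->
    pair_prod B j *m B l = B l *m pair_prod B j.
  move=> l1 l2; apply: pair_prod_comm => i' i'j; first by apply: ha; apply: ltS.
  by apply: hc => //; [apply: ltS | rewrite neq_ltn (leq_trans i'j)].
have d1 : j.*2 != j.*2.+1 by rewrite neq_ltn ltnSn.
have hab := hc _ _ lt1 lt2 d1.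
(* If [i] belongs to the last pair, the shorter product commutes with [B i] and the sign comes from
   that pair; otherwise the pair commutes with [B i] and the sign comes from the induction
   hypothesis. *)
rewrite ha // doubleS ltnS leq_eqVlt => /orP[/eqP ->|].
  rewrite [in RHS]mulmxA -hcomm // -!mulmxA -mulmxN; congr (_ *m _).
  by rewrite !mulNmx !mulmxN opprK !mulmxA hab mulNmx opprK.
rewrite ltnS leq_eqVlt => /orP[/eqP ->|ij].
  rewrite [in RHS]mulmxA -hcomm // -!mulmxA -mulmxN; congr (_ *m _).
  by rewrite !mulNmx !mulmxN opprK hab mulmxN.
rewrite -mulmxA [X in _ *m X]anticomm_mul_comm ?mulmxA.
- rewrite IH ?mulNmx //; first by move=> *; apply: ha; apply: ltS.
  by move=> *; apply: hc => //; apply: ltS.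
- by rewrite mulNmx mulmxN hc // ?(ltS _ ij) // neq_ltn ij orbT.
- by rewrite hc // ?(ltS _ ij) // neq_ltn (ltn_trans ij) ?orbT.
Qed.

(** Each pair [B_(2i)^H B_(2i+1)] is skew, and the pairs commute with one another, so each of the
    [j] pairs contributes one sign. *)
Lemma pair_prod_adj j B :
  (forall i, (i < j.*2)%N -> B i ^t* = - B i) ->
  (forall i l, (i < j.*2)%N -> (l < j.*2)%N -> i != l ->
     B i *m B l = - (B l *m B i)) ->
  pair_prod B j ^t* = (-1) ^+ j *: pair_prod B j.
Proof.
elim: j => [|j IH] ha hc /=; first by rewrite trmxC1 expr0 scale1r.
have lt1 : (j.*2 < j.+1.*2)%N by rewrite doubleS.
have lt2 : (j.*2.+1 < j.+1.*2)%N by rewrite doubleS.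
have ltS i' : (i' < j.*2)%N -> (i' < j.+1.*2)%N by move/ltn_trans; apply.
have hcomm l : (l >= j.*2)%N -> (l < j.+1.*2)%N ->
    pair_prod B j *m B l = B l *m pair_prod B j.
  move=> l1 l2; apply: pair_prod_comm => i' i'j; first by apply: ha; apply: ltS.
  by apply: hc => //; [apply: ltS | rewrite neq_ltn (leq_trans i'j)].
rewrite !trmxC_mul IH; last 2 first.
- by move=> *; apply: ha; apply: ltS.
- by move=> *; apply: hc => //; apply: ltS.
rewrite trmxCK !ha // -scalemxAr exprS mulN1r scaleNr -scalerN; congr (_ *: _).
rewrite !mulNmx mulmxN opprK mulmxA hcomm // -!mulmxA hcomm // !mulmxA.
by rewrite (hc _ _ lt1 lt2) ?mulNmx // neq_ltn ltnSn.
Qed.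

Lemma pair_prod_unitary j A :
  (forall i, (i < j.*2)%N -> A i ^t* *m A i = 1%:M) ->
  pair_prod A j ^t* *m pair_prod A j = 1%:M.
Proof.
elim: j => [|j IH] hA /=; first by rewrite mulmx1 trmxC1.
have lt1 : (j.*2 < j.+1.*2)%N by rewrite doubleS.
have lt2 : (j.*2.+1 < j.+1.*2)%N by rewrite doubleS.
rewrite !trmxC_mul trmxCK !mulmxA -[_ *m _ *m pair_prod _ _]mulmxA IH ?mulmx1.
  rewrite -[_ *m _ *m A _ ^t*]mulmxA (mulmx1C (hA _ lt1)) mulmx1.
  exact: hA.
by move=> i ij; apply: hA; apply: ltn_trans ij _.
Qed.

(* The value of the alternating product on the coefficients of [Hrec]. *)
Definition chir_const j : C := 'i * (- 'i) ^+ j.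

Lemma chir_constS j : chir_const j = chir_const j.+1 * 'i.
Proof.
rewrite /chir_const exprS mulrA mulrN -expr2 sqrCi opprK mul1r.
by rewrite mulrC.
Qed.

(** This sign is opposite to the one in [pair_prod_adj], which makes the matrix [G] of the extension
    below skew. *)
Lemma chir_const_adj j : (chir_const j)^* = (-1) ^+ j.+1 * chir_const j.
Proof.
have ss : (-1) ^+ j * (-1) ^+ j = 1 :> C by rewrite -exprMn mulrNN mulr1 expr1n.
rewrite /chir_const rmorphM rmorphXn rmorphN /= conjCi opprK exprS.
rewrite -[- 'i]mulN1r exprMn [_ * (_ * _ ^+ j)]mulrCA.
by rewrite !mulrA -[-1 * _ * _]mulrA ss mulr1.
Qed.

Lemma chir_const_norm j : (chir_const j)^* * chir_const j = 1.
Proof.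
rewrite /chir_const rmorphM rmorphXn rmorphN /= conjCi opprK mulrACA -exprMn.
by rewrite mulNr mulrN -expr2 sqrCi opprK expr1n mulr1.
Qed.

(** The prescribed product determines the new matrix; the Clifford relations for it follow from the
    (anti)commutation properties of the alternating product. *)
Lemma hod_family_extend j A : hod_family j.*2.+1 A ->
  exists2 X, hod_family j.*2.+2 (fun i => if i == j.*2.+1 then X else A i) &
    pair_prod (fun i => if i == j.*2.+1 then X else A i) j.+1
      = (chir_const j)%:M.
Proof.
move=> hA; set c := chir_const j; set D := A j.*2.
have hD : D ^t* *m D = 1%:M by apply: hA.1.
have hD' := mulmx1C hD.
(* Normalising the unpaired matrix [D] to the identity makes the other matrices skew and
   anticommuting. The factor [1%:M] gives the shape expected by [hod_family_equiv]. *)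
pose B i := D ^t* *m A i *m 1%:M.
have hB : hod_family j.*2.+1 B.
  by apply: hod_family_equiv => //; rewrite ?trmxCK ?trmxC1 ?mulmx1.
have Bl : B j.*2 = 1%:M by rewrite /B mulmx1 hD.
pose P := pair_prod A j.
have PB : pair_prod B j = P.
  by rewrite pair_prod_equiv ?trmxCK ?trmxC1 ?mulmx1 ?mul1mx.
have ltS i : (i < j.*2)%N -> (i < j.*2.+1)%N by move/leqW.
have ha i : (i < j.*2)%N -> B i ^t* = - B i.
  by move=> ij; apply: (hod_family_adj hB _ Bl); rewrite // ?ltS // neq_ltn ij.
have hc i l : (i < j.*2)%N -> (l < j.*2)%N -> i != l -> B i *m B l = - (B l *m B i).
  move=> ij lj il; apply: (hod_family_anticomm hB _ Bl) => //; rewrite ?ltS //.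
    by rewrite neq_ltn ij.
  by rewrite neq_ltn lj.
have Padj : P ^t* = (-1) ^+ j *: P by rewrite -PB; apply: pair_prod_adj.
have PP : P ^t* *m P = 1%:M.
  by apply: pair_prod_unitary => i ij; apply: hA.1; apply: ltS.
have Panti i : (i < j.*2)%N -> P *m B i = - (B i *m P).
  by rewrite -PB; apply: pair_prod_anticomm.
(* With [X = D G], the equation [P D^H X = c] reads [P G = c], whence [G = c P^H]. *)
pose G := c *: P ^t*.
have Gadj : G ^t* = - G.
  rewrite /G trmxCZ trmxCK chir_const_adj Padj !scalerA -scaleNr; congr (_ *: _).
  by rewrite exprS -mulrA mulN1r mulrC.
have GG : G ^t* *m G = 1%:M.
  rewrite /G trmxCZ trmxCK -scalemxAl -scalemxAr scalerA chir_const_norm scale1r.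
  exact: mulmx1C.
have Ganti i : (i < j.*2)%N -> G *m B i = - (B i *m G).
  by move=> ij; rewrite /G Padj !scalerA -scalemxAl Panti // -scalemxAr scalerN.
have AG i : (i < j.*2.+1)%N -> A i ^t* *m (D *m G) = - ((D *m G) ^t* *m A i).
  move=> ij; rewrite trmxC_mul Gadj mulNmx mulNmx opprK -mulmxA.
  have -> : A i ^t* *m (D *m G) = B i ^t* *m G.
    by rewrite /B mulmx1 trmxC_mul trmxCK mulmxA.
  have -> : D ^t* *m A i = B i by rewrite /B mulmx1.
  move: ij; rewrite ltnS leq_eqVlt => /orP[/eqP ->|ij].
    by rewrite Bl trmxC1 mul1mx mulmx1.
  by rewrite Ganti // ha // mulNmx.
have XX : (D *m G) ^t* *m (D *m G) = 1%:M.
  by rewrite trmxC_mul mulmxA -[_ *m D]mulmxA hD mulmx1.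
exists (D *m G); last first.
  rewrite /= eqxx eqn_leq ltnn andbF.
  have -> : pair_prod (fun i => if i == j.*2.+1 then D *m G else A i) j = P.
    by apply: eq_pair_prod => i ij; rewrite ltn_eqF // ltnS ltnW.
  rewrite -/D mulmxA -mulmxA [D ^t* *m _]mulmxA hD mul1mx /G -scalemxAr.
  by rewrite (mulmx1C PP) scalemx1.
split=> [i|i l]; rewrite !ltnS.
  by case: eqP => // /eqP ne; rewrite leq_eqVlt (negbTE ne); apply: hA.1.
case: (i =P j.*2.+1) => [->|/eqP ni]; case: (l =P j.*2.+1) => [->|/eqP nl].
- by rewrite eqxx.
- by rewrite [(l <= _)%N]leq_eqVlt (negbTE nl) => _ lj _; rewrite AG // opprK.
- by rewrite leq_eqVlt (negbTE ni) => ij _ _; rewrite AG.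
- by rewrite leq_eqVlt (negbTE ni) [(l <= _)%N]leq_eqVlt (negbTE nl); apply: hA.2.
Qed.

End Clifford.

(** * Splitting along the eigenspaces of a skew unitary matrix *)

Section Splitting.
Variable C : numClosedFieldType.

Definition grading p : 'M[C]_(p + p) := block_mx 'i%:M 0 0 (- 'i)%:M.

(** The involution [S = -iG] has eigenvalues 1 and -1, and [B] exchanges its eigenspaces. An
    orthonormal basis [W1] of the first is therefore carried by [B] to one of the second.
    Eigenvectors are rows, acted on from the right. *)
Lemma eigenspaces_anticomm n (G B : 'M[C]_n) :
  G ^t* = - G -> G ^t* *m G = 1%:M -> B ^t* *m B = 1%:M ->
  B *m G = - (G *m B) ->
  exists p (W : 'M[C]_(p + p, n)),
    [/\ (p + p = n)%N, W *m W ^t* = 1%:M & W *m G = grading p *m W].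
Proof.
move=> Ga GG BB BG; have BB' := mulmx1C BB.
pose S : 'M[C]_n := - 'i *: G.
have SS : S *m S = 1%:M.
  rewrite /S -scalemxAl -scalemxAr scalerA mulrNN -expr2 sqrCi scaleN1r.
  by rewrite -mulNmx -Ga.
have GS : G = 'i *: S by rewrite /S scalerA mulrN -expr2 sqrCi opprK scale1r.
have BS : B *m S = - (S *m B) by rewrite /S -scalemxAl -scalemxAr BG scalerN.
(* Since [S] squares to 1, the row space of [1 + S] is the eigenspace of [S] for 1. *)
pose T := 1%:M + S; pose p : nat := \rank T.
pose W1 : 'M[C]_(p, n) := schmidt (row_base T).
have W1u : W1 *m W1 ^t* = 1%:M.
  by apply/unitarymxP; apply: schmidt_unitarymx; apply: rank_leq_row.
have W1S : W1 *m S = W1.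
  have : (W1 <= T)%MS.
    by have /eqmxP/andP[] := eqmx_trans
      (eqmx_schmidt_free (row_base_free T)) (eq_row_base T).
  by case/submxP=> Y ->; rewrite -mulmxA mulmxDl mul1mx SS addrC.
have W1G : W1 *m G = 'i *: W1 by rewrite GS -scalemxAr W1S.
have W2G : W1 *m B *m G = - 'i *: (W1 *m B).
  by rewrite -mulmxA BG mulmxN mulmxA W1G -scalemxAl scaleNr.
(* Moving the skew matrix [G] from one side of the Hermitian product to the other shows that [i]
   times this product equals its own negative. *)
have W12 : W1 *m (W1 *m B) ^t* = 0.
  apply: eqNmx; apply: (scalerI (neq0Ci _)).
  rewrite scalemxAl -W1G -mulmxA -[G]trmxCK -trmxC_mul Ga mulmxN W2G.
  by rewrite scaleNr opprK trmxCZ conjCi -scalemxAr scaleNr scalerN.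
have W21 : W1 *m B *m W1 ^t* = 0.
  by rewrite -[LHS]trmxCK trmxC_mul trmxCK W12 trmx0 map_mx0.
pose W := col_mx W1 (W1 *m B).
have WW : W *m W ^t* = 1%:M.
  rewrite /W tr_col_mx map_row_mx mul_col_row W12 W21 W1u trmxC_mul mulmxA.
  by rewrite -(mulmxA W1) BB' mulmx1 W1u -scalar_mx_block.
exists p, W; split=> //.
  apply/eqP; rewrite eqn_leq; apply/andP; split.
    have /unitarymxP/mxrank_unitary <- := WW; exact: rank_leq_col.
  (* The last summand is [1 - S], of rank at most [p]; hence [n <= p + p]. The other inequality came
     from the orthonormal rows of [W]. *)
  have e2 : (2 : C) *: (1%:M : 'M[C]_n) = T + B *m T *m B ^t*.
    rewrite /T mulmxDr BS mulmx1 mulmxDl mulNmx -mulmxA BB' mulmx1 addrACA subrr.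
    by rewrite addr0 scaler_nat mulr2n.
  rewrite -{1}(mxrank1 C n) -(mxrank_scale_nz (1%:M : 'M[C]_n) (a := 2)) ?pnatr_eq0 //.
  rewrite e2; apply: leq_trans (mxrank_add _ _) _; rewrite leq_add2l.
  by apply: leq_trans (mxrankM_maxl _ _) (mxrankM_maxr _ _).
rewrite /grading /W mul_col_mx W1G W2G mul_block_col !mul0mx addr0 add0r.
by rewrite !mul_scalar_mx.
Qed.

(** On each diagonal block [grading p] is a nonzero scalar, so anticommutation makes the block equal
    to its negative; skewness relates the two remaining blocks. *)
Lemma anticomm_grading p (M : 'M[C]_(p + p)) :
  M ^t* = - M -> M *m grading p = - (grading p *m M) ->
  M = block_mx 0 (ursubmx M) (- (ursubmx M) ^t*) 0.
Proof.
rewrite -{1 2 3 4}(submxK M) /grading trmxC_block opp_block_mx.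
case/eq_block_mx => _ _ hdl _.
rewrite !mulmx_block !mulmx0 !mul0mx !addr0 !add0r opp_block_mx.
case/eq_block_mx; rewrite !mul_mx_scalar !mul_scalar_mx -!scalerN.
move=> /(scalerI (neq0Ci _))/eqNmx hul _ _.
have nz : - 'i != 0 :> C by rewrite oppr_eq0 (neq0Ci _).
move=> /(scalerI nz)/eqNmx hdr.
by rewrite -{1}(submxK M) hul hdr hdl opprK.
Qed.

Definition skew_block p (c : 'M[C]_p) : 'M[C]_(p + p) :=
  block_mx 0 c (- c ^t*) 0.

Lemma skew_block_mul p (a b : 'M[C]_p) :
  (skew_block a) ^t* *m skew_block b = block_mx (a *m b ^t*) 0 0 (a ^t* *m b).
Proof.
rewrite /skew_block trmxC_block trmxCN trmxCK mulmx_block.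
rewrite !trmx0 !map_mx0 !(mul0mx, mulmx0) !add0r !addr0.
by rewrite mulNmx mulmxN opprK.
Qed.

(** Each pair is block diagonal with lower right block [a^H b], exactly the factor that occurs in
    [pair_prod c]. *)
Lemma pair_prod_skew p (c : nat -> 'M[C]_p) j :
  exists X, pair_prod (fun i => skew_block (c i)) j
     = block_mx X 0 0 (pair_prod c j).
Proof.
elim: j => [|j [X IH]] /=; first by exists 1%:M; rewrite -scalar_mx_block.
exists (X *m (c j.*2 *m c j.*2.+1 ^t*)).
by rewrite IH skew_block_mul mulmx_block !(mul0mx, mulmx0) !add0r !addr0.
Qed.

Lemma hod_family_skew p m (c : nat -> 'M[C]_p) :
  hod_family m (fun i => skew_block (c i)) -> hod_family m c.
Proof.
case=> h1 h2; split=> [i im|i l im lm il].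
  have := h1 i im; rewrite skew_block_mul scalar_mx_block.
  by case/eq_block_mx.
have := h2 i l im lm il; rewrite !skew_block_mul opp_block_mx.
by case/eq_block_mx.
Qed.

End Splitting.

(** * Decomposition of normalised families of even length *)

Section Decomposition.
Variable R : realType.
Local Notation C := (R[i]).
Local Notation "x %:C" := (real_complex R x).

Lemma complex_split (a b : R) : Complex a b = a%:C + b%:C * 'i.
Proof. by rewrite -complexiE; simpc. Qed.

Lemma conjC_complex (a b : R) : (Complex a b)^* = Complex a (- b).
Proof. by []. Qed.

Lemma conjC_real_complex (a : R) : (a%:C)^* = a%:C.
Proof. by rewrite conjC_complex oppr0. Qed.

Lemma mulmx_cast3 (F : pzRingType) m m' n p (e : m = m')
    (A : 'M[F]_(n, m)) (B : 'M[F]_m) (D : 'M[F]_(m, p)) :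
  castmx (erefl, e) A *m castmx (e, e) B *m castmx (e, erefl) D = A *m B *m D.
Proof. by case: _ / e; rewrite !castmx_id. Qed.

Lemma mulmx_cast2 (F : pzRingType) m m' n p (e : m = m')
    (A : 'M[F]_(n, m)) (D : 'M[F]_(m, p)) :
  castmx (erefl, e) A *m castmx (e, erefl) D = A *m D.
Proof. by case: _ / e; rewrite !castmx_id. Qed.

Lemma sum_block_mx (F : pzRingType) (I : Type) (r : seq I) m1 m2 n1 n2
    (a : I -> 'M[F]_(m1, n1)) (b : I -> 'M[F]_(m1, n2))
    (c : I -> 'M[F]_(m2, n1)) (d : I -> 'M[F]_(m2, n2)) :
  \sum_(i <- r) block_mx (a i) (b i) (c i) (d i)
  = block_mx (\sum_(i <- r) a i) (\sum_(i <- r) b i)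
             (\sum_(i <- r) c i) (\sum_(i <- r) d i).
Proof.
elim: r => [|i r IH]; first by rewrite !big_nil block_mx0.
by rewrite !big_cons IH add_block_mx.
Qed.

(* [U] and [V] stand for the block columns, resp. block rows, of two unitary
   matrices; only their completeness relations are recorded, since the
   orthogonality relations follow from [d * 2 ^ j = n]. *)
Definition Hrec_decomp n j (A : nat -> 'M[C]_n) :=
  exists d (U : 'I_d -> 'M[C]_(n, 2 ^ j)) (V : 'I_d -> 'M[C]_(2 ^ j, n)),
    [/\ (d * 2 ^ j)%N = n, \sum_l U l *m U l ^t* = 1%:M,
        \sum_l V l ^t* *m V l = 1%:M &
        forall x : nat -> R, \sum_(i < j.*2.+2) (x i)%:C *: A i
                             = \sum_l U l *m Hrec x j *m V l].

Lemma Hrec_decomp_equiv n j (A B : nat -> 'M[C]_n) (P Q : 'M[C]_n) :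
  P *m P ^t* = 1%:M -> Q ^t* *m Q = 1%:M ->
  (forall i, A i = P *m B i *m Q) -> Hrec_decomp j B -> Hrec_decomp j A.
Proof.
move=> hP hQ AB [d [U [V [dn UU VV eB]]]].
exists d, (fun l => P *m U l), (fun l => V l *m Q); split=> //.
- under eq_bigr => l _ do rewrite trmxC_mul mulmxA -(mulmxA P).
  by rewrite -mulmx_suml -mulmx_sumr UU mulmx1.
- under eq_bigr => l _ do rewrite trmxC_mul mulmxA -(mulmxA (Q ^t*)).
  by rewrite -mulmx_suml -mulmx_sumr VV mulmx1.
move=> x; under eq_bigr => i _ do rewrite AB scalemxAl scalemxAr.
rewrite -mulmx_suml -mulmx_sumr eB mulmx_sumr mulmx_suml.
by apply: eq_bigr => l _; rewrite !mulmxA.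
Qed.

Lemma Hrec_decomp0 n (A : nat -> 'M[C]_n) :
  hod_family 2 A -> pair_prod A 1 = (chir_const C 0)%:M -> Hrec_decomp 0 A.
Proof.
move=> hA /=; rewrite mul1mx /chir_const expr0 mulr1 => h01.
have A00 := hA.1 0%N isT.
(* The normalisation leaves the single term [(x_0 + i x_1) A_0], which is split into the columns of
   [A_0] times the rows of the identity. *)
have A1 : A 1%N = 'i *: A 0%N.
  by rewrite -[A 1%N]mul1mx -(mulmx1C A00) -mulmxA h01 mul_mx_scalar.
exists n, (fun l => col l (A 0%N)), (fun l => row l 1%:M); split.
- by rewrite expn0 muln1.
- rewrite -(mulmx1C A00); apply/matrixP=> a b; rewrite summxE !mxE.
  by apply: eq_bigr => l _; rewrite !mxE big_ord1 !mxE.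
- rewrite -[RHS]mulmx1 -[X in X *m _]trmxC1; apply/matrixP=> a b; rewrite summxE !mxE.
  by apply: eq_bigr => l _; rewrite !mxE big_ord1 !mxE.
move=> x; rewrite !big_ord_recl big_ord0 addr0 /= /bump /= A1 scalerA -scalerDl.
rewrite -complex_split.
under eq_bigr => l _ do rewrite mul_mx_scalar -scalemxAl.
rewrite -scaler_sumr; congr (_ *: _).
rewrite -[LHS]mulmx1; apply/matrixP=> a b; rewrite summxE !mxE.
by apply: eq_bigr => l _; rewrite !mxE big_ord1 !mxE.
Qed.

Lemma Hrec_decompS p j (M : nat -> 'M[C]_(p + p)) (c : nat -> 'M[C]_p) :
  (forall i, (i < j.*2.+2)%N -> M i = skew_block (c i)) ->
  M j.*2.+2 = 1%:M -> M j.*2.+3 = grading C p ->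
  Hrec_decomp j c -> Hrec_decomp j.+1 M.
Proof.
move=> Mc M2 M3 [d [U [V [dn UU VV ec]]]].
(* The antidiagonal right factor swaps the columns of the recursion, moving its scalar blocks onto
   the diagonal, where completeness sums them to scalar matrices. The sign of [V l ^t*] turns the
   lower blocks into [- cx^H] and the conjugate scalar. *)
exists d, (fun l => castmx (erefl, pow2S_eq j) (block_mx (U l) 0 0 (- V l ^t*))),
  (fun l => castmx (pow2S_eq j, erefl) (block_mx 0 (V l) (U l ^t*) 0)); split.
- by rewrite expnS mulnCA dn mul2n addnn.
- under eq_bigr => l _.
    rewrite trmxC_cast mulmx_cast2 trmxC_block trmxCN trmxCK !trmx0 !map_mx0.
    rewrite mulmx_block !(mul0mx, mulmx0) !add0r !addr0 mulNmx mulmxN opprK.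
    over.
  by rewrite sum_block_mx UU VV !sumr_const !mul0rn -scalar_mx_block.
- under eq_bigr => l _.
    rewrite trmxC_cast mulmx_cast2 trmxC_block trmxCK !trmx0 !map_mx0.
    rewrite mulmx_block !(mul0mx, mulmx0) !add0r !addr0.
    over.
  by rewrite sum_block_mx UU VV !sumr_const !mul0rn -scalar_mx_block.
move=> x; set cx := \sum_(i < j.*2.+2) (x i)%:C *: c i.
have -> : \sum_(i < j.+1.*2.+2) (x i)%:C *: M i =
    block_mx (Complex (x j.*2.+2) (x j.*2.+3))%:M cx
             (- cx ^t*) (Complex (x j.*2.+2) (- x j.*2.+3))%:M.
  rewrite doubleS 2!big_ord_recr /= M2 M3.
  under eq_bigr => i _.
    rewrite Mc // /skew_block scale_block_mx !scaler0 scalerN.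
    (* Real coefficients pass through the adjoint, so the lower left blocks add up to [- cx^H]. *)
    rewrite -{2}conjC_real_complex -trmxCZ.
    over.
  rewrite sum_block_mx !big1_eq sumrN -trmxC_sum -/cx.
  rewrite scalemx1 scalar_mx_block /grading scale_block_mx !scaler0 !add_block_mx.
  rewrite !addr0 !add0r !scale_scalar_mx -!raddfD /=.
  by rewrite !complex_split rmorphN mulNr mulrN.
have cxE : cx = \sum_l U l *m Hrec x j *m V l by apply: ec.
under eq_bigr => l _.
  rewrite [Hrec _ _]/= mulmx_cast3 !mulmx_block !(mul0mx, mulmx0) !add0r !addr0.
  rewrite !(mulNmx, mulmxN) opprK !mul_mx_scalar -!scalemxAl.
  over.
rewrite sum_block_mx -!scaler_sumr UU VV !scalemx1 cxE sumrN trmxC_sum.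
congr (block_mx _ _ (- _) _); apply: eq_bigr => l _.
by rewrite !trmxC_mul mulmxA.
Qed.

Lemma Hrec_decomp_hod j n (A : nat -> 'M[C]_n) :
  hod_family j.*2.+2 A -> pair_prod A j.+1 = (chir_const C j)%:M ->
  Hrec_decomp j A.
Proof.
elim: j n A => [|j IH] n A hA cA; first exact: Hrec_decomp0.
have lt2 : (j.*2.+2 < j.+1.*2.+2)%N by rewrite doubleS.
have lt3 : (j.*2.+3 < j.+1.*2.+2)%N by rewrite doubleS.
have ltS i : (i < j.*2.+2)%N -> (i < j.+1.*2.+2)%N by move/ltn_trans; apply.
pose D := A j.*2.+2.
have DD : D ^t* *m D = 1%:M by apply: hA.1.
pose B i := D ^t* *m A i *m 1%:M.
have hB : hod_family j.+1.*2.+2 B.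
  by apply: hod_family_equiv => //; rewrite ?trmxCK ?trmxC1 ?mulmx1 // mulmx1C.
have B2 : B j.*2.+2 = 1%:M by rewrite /B mulmx1 DD.
(* Here [G] is the last matrix, and [B 0] serves as a unitary exchanging its eigenspaces. *)
have [||||p [W [pn WW WG]]] := @eigenspaces_anticomm _ _ (B j.*2.+3) (B 0%N).
- by apply: (hod_family_adj hB lt2 B2) => //; rewrite neq_ltn ltnSn orbT.
- exact: hB.1.
- exact: hB.1.
- by apply: (hod_family_anticomm hB lt2 B2) => //; rewrite neq_ltn ltnSn orbT.
subst n; have WW' := mulmx1C WW.
(* This is [B i] in the basis [W], written as an equivalence applied directly to [A]. *)
pose M i := (W *m D ^t*) *m A i *m W ^t*.
have hWD : (W *m D ^t*) ^t* *m (W *m D ^t*) = 1%:M.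
  by rewrite trmxC_mul trmxCK mulmxA -(mulmxA D) WW' mulmx1 (mulmx1C DD).
have hWa : W ^t* ^t* *m W ^t* = 1%:M by rewrite trmxCK.
have hM : hod_family j.+1.*2.+2 M by apply: hod_family_equiv.
have M2 : M j.*2.+2 = 1%:M by rewrite /M -(mulmxA W) DD mulmx1 WW.
have M3 : M j.*2.+3 = grading C p.
  have -> : M j.*2.+3 = W *m B j.*2.+3 *m W ^t* by rewrite /M /B mulmx1 !mulmxA.
  by rewrite WG -mulmxA WW mulmx1.
have Mc i : (i < j.*2.+2)%N -> M i = skew_block (ursubmx (M i)).
  move=> ij; apply: anticomm_grading.
    by apply: (hod_family_adj hM lt2 M2); rewrite ?ltS // neq_ltn ij.
  rewrite -M3; apply: (hod_family_anticomm hM lt2 M2); rewrite ?(ltS _ ij) //.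
  - by rewrite neq_ltn ij.
  - by rewrite neq_ltn ltnSn orbT.
  - by rewrite neq_ltn (ltn_trans ij).
pose c i := ursubmx (M i).
have dM : Hrec_decomp j.+1 M.
  apply: (@Hrec_decompS _ _ _ c) => //; apply: IH.
    apply: hod_family_skew; split=> [i ij|i l ij lj il]; rewrite -!Mc //.
      by apply: hM.1; apply: ltS.
    by apply: hM.2 => //; apply: ltS.
  (* The normalisation descends to [c]: the last pair of [M] is [(1, G)], with lower right block
     [-i], so the product for [c] is [i] times [chir_const j.+1], that is, [chir_const j]. *)
  have : pair_prod M j.+2 = (chir_const C j.+1)%:M.
    rewrite pair_prod_equiv // cA mul_mx_scalar -scalemxAl trmxCK WW.
    by rewrite scalemx1.
  rewrite -[pair_prod _ j.+2]/(pair_prod M j.+1 *m (M j.+1.*2 ^t* *m M j.+1.*2.+1)).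
  rewrite doubleS M2 M3 trmxC1 mul1mx.
  have [X] := pair_prod_skew c j.+1.
  rewrite -(eq_pair_prod (A := M)) => [->|i ij]; last exact: Mc.
  rewrite mulmx_block !(mul0mx, mulmx0) !add0r !addr0 [RHS]scalar_mx_block.
  case/eq_block_mx => _ _ _; rewrite mul_mx_scalar => e.
  rewrite chir_constS -[RHS]scalemx1 mulrC -scalerA scalemx1 -e scalerA.
  by rewrite mulrN -expr2 sqrCi opprK scale1r.
apply: (Hrec_decomp_equiv (P := D *m W ^t*) (Q := W) _ WW' _ dM).
  by rewrite trmxC_mul trmxCK mulmxA -(mulmxA D) WW' mulmx1 (mulmx1C DD).
move=> i; rewrite /M -!mulmxA WW' mulmx1 !mulmxA -(mulmxA D) WW' mulmx1.
by rewrite (mulmx1C DD) mul1mx.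
Qed.

End Decomposition.

(** * Real linearity and the design identity of [Hrec] *)

Lemma castmx_lin (F : pzRingType) m n m' n' (e : (m = m') * (n = n')) a
    (A B : 'M[F]_(m, n)) :
  castmx e (a *: A + B) = a *: castmx e A + castmx e B.
Proof. by case: e => e1 e2; case: _ / e1; case: _ / e2; rewrite !castmx_id. Qed.

Lemma castmx_mul (F : pzRingType) m m' (e : m = m') (A B : 'M[F]_m) :
  castmx (e, e) A *m castmx (e, e) B = castmx (e, e) (A *m B).
Proof. by case: _ / e; rewrite !castmx_id. Qed.

Lemma castmx_scalar (F : pzRingType) m m' (e : m = m') (a : F) :
  castmx (e, e) a%:M = a%:M.
Proof. by case: _ / e; rewrite !castmx_id. Qed.

Section HrecTheory.
Variable R : realType.
Local Notation C := (R[i]).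
Local Notation "x %:C" := (real_complex R x).

Lemma eq_Hrec (x y : nat -> R) j : x =1 y -> Hrec x j = Hrec y j.
Proof. by move=> xy; elim: j => [|j IH] /=; rewrite ?IH !xy. Qed.

Lemma Complex_lin (a p q u v : R) :
  Complex (a * p + u) (a * q + v) = a%:C * Complex p q + Complex u v.
Proof. by rewrite !complex_split !rmorphD !rmorphM /= mulrDr !mulrDl !mulrA addrACA. Qed.

Lemma Hrec_lin a (x y : nat -> R) j :
  Hrec (fun q => a * x q + y q) j = a%:C *: Hrec x j + Hrec y j.
Proof.
elim: j => [|j IH] /=.
  by rewrite Complex_lin scale_scalar_mx -raddfD.
rewrite IH Complex_lin opprD -mulrN Complex_lin trmxCD trmxCZ conjC_real_complex.
rewrite -castmx_lin scale_block_mx add_block_mx scalerN -opprD.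
by rewrite !scale_scalar_mx -!raddfD.
Qed.

Lemma Hrec0 j : Hrec (fun=> 0 : R) j = 0.
Proof.
(* Linearity at zero gives [H = H + H]. *)
have := Hrec_lin 1 (fun=> 0 : R) (fun=> 0) j.
rewrite scale1r (@eq_Hrec _ (fun=> 0)) => [/eqP|q]; last by rewrite mulr0 addr0.
by rewrite -subr_eq0 opprD addrA subrr sub0r oppr_eq0 => /eqP.
Qed.

Lemma Hrec_sum (I : Type) (r : seq I) (a : I -> R) (f : I -> nat -> R) j :
  Hrec (fun q => \sum_(i <- r) a i * f i q) j = \sum_(i <- r) (a i)%:C *: Hrec (f i) j.
Proof.
elim: r => [|i r IH].
  by rewrite big_nil -(Hrec0 j); apply: eq_Hrec => q; rewrite big_nil.
by rewrite big_cons -IH -Hrec_lin; apply: eq_Hrec => q; rewrite big_cons.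
Qed.

Lemma Complex_norm (a b : R) :
  Complex a b * Complex a (- b) = (a ^+ 2 + b ^+ 2)%:C.
Proof. 
apply/eqP; rewrite eq_complex /= !mulrN opprK -!expr2 eqxx /=.
by rewrite [b * a]mulrC addNr. Qed.

(** Both orders of the product are proved together: as the recursion contains both [H] and [H^H],
    either order at the next size involves both at the previous one. *)
Lemma Hrec_hod (x : nat -> R) j : let s := (\sum_(i < j.*2.+2) x i ^+ 2)%:C in
  Hrec x j ^t* *m Hrec x j = s%:M /\ Hrec x j *m Hrec x j ^t* = s%:M.
Proof.
elim: j => [|j [IH1 IH2]] /=.
  rewrite trmxC_scalar conjC_complex -!scalar_mxM [Complex _ (- _) * _]mulrC.
  by rewrite Complex_norm !big_ord_recl big_ord0 addr0.
rewrite trmxC_cast /= trmxC_block trmxCN trmxCK !trmxC_scalar !conjC_complex opprK.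
set H := Hrec x j in IH1 IH2 *; set s := (\sum_(i < j.*2.+2) _)%:C in IH1 IH2.
set u := x _; set v := x _; set z := Complex u v; set zb := Complex u (- v).
have zE : z * zb = (u ^+ 2 + v ^+ 2)%:C by exact: Complex_norm.
have -> : (\sum_(i < j.+1.*2.+2) x i ^+ 2)%:C = s + z * zb.
  by rewrite doubleS 2!big_ord_recr /= zE -addrA rmorphD.
rewrite !castmx_mul !mulmx_block IH1 IH2 !(mulNmx, mulmxN) !opprK.
rewrite !mul_mx_scalar !mul_scalar_mx !scale_scalar_mx !subrr !addNr.
by rewrite -!raddfD /= [zb * z]mulrC [_ + s]addrC -!scalar_mx_block !castmx_scalar.
Qed.

End HrecTheory.

(** * Block diagonal, block row and block column matrices *)

Lemma trmxC_mxdiag (C : numClosedFieldType) d q (H : 'M[C]_q) :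
  (\mxdiag_(l < d) H) ^t* = \mxdiag_(l < d) (H ^t*).
Proof.
rewrite tr_mxdiag; apply/matrixP => a b; rewrite !mxE.
by case: eqP => _; rewrite ?conform_mx_id !mxE ?rmorph0.
Qed.

Lemma trmxC_mxrow (C : numClosedFieldType) d q n (U : 'I_d -> 'M[C]_(n, q)) :
  (\mxrow_l U l) ^t* = \mxcol_l (U l ^t*).
Proof. by rewrite tr_mxrow; apply/matrixP => a b; rewrite !mxE. Qed.

Lemma trmxC_mxcol (C : numClosedFieldType) d q n (V : 'I_d -> 'M[C]_(q, n)) :
  (\mxcol_l V l) ^t* = \mxrow_l (V l ^t*).
Proof. by rewrite tr_mxcol; apply/matrixP => a b; rewrite !mxE. Qed.

Lemma mxdiag_sumZ (F : pzRingType) d q (I : finType) (a : I -> F)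
    (H : I -> 'M[F]_q) :
  \mxdiag_(l < d) (\sum_i a i *: H i) = \sum_i a i *: \mxdiag_(l < d) H i.
Proof.
rewrite mxdiag_sum; apply: eq_bigr => i _; apply/matrixP => r c; rewrite !mxE.
by case: eqP => _; rewrite ?conform_mx_id !mxE ?mulr0.
Qed.

Lemma castmx_sumZ (F : pzRingType) m n m' n' (e : (m = m') * (n = n'))
    (I : finType) (a : I -> F) (A : I -> 'M[F]_(m, n)) :
  castmx e (\sum_i a i *: A i) = \sum_i a i *: castmx e (A i).
Proof.
case: e => e1 e2; case: _ / e1; case: _ / e2; rewrite castmx_id.
by apply: eq_bigr => i _; rewrite castmx_id.
Qed.

Lemma mxdiag_mul (F : pzRingType) d q (H K : 'M[F]_q) :
  (\mxdiag_(l < d) H) *m (\mxdiag_(l < d) K) = \mxdiag_(l < d) (H *m K).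
Proof.
rewrite {2}/mxdiag mul_mxdiag_mxblock /mxdiag; apply/eq_mxblock => i l.
by case: eqP => _; rewrite ?conform_mx_id ?mulmx0.
Qed.

(** * Existence and normal form of square designs *)

Section HOD.
Variables (R : realType) (n : nat).
Local Notation C := (R[i]).
Local Notation "x %:C" := (real_complex R x).

Lemma ext_lt m (x : 'I_m -> R) q (qm : (q < m)%N) : ext x q = x (Ordinal qm).
Proof. by rewrite /ext insubT. Qed.

Lemma ext_ge m (x : 'I_m -> R) q : (m <= q)%N -> ext x q = 0.
Proof. by move=> mq; rewrite /ext insubF // ltnNge mq. Qed.

Lemma ext_ord m (x : 'I_m -> R) (i : 'I_m) : ext x i = x i.
Proof. by rewrite /ext valK. Qed.

Lemma ext_sum m (x : 'I_m -> R) q : ext x q = \sum_(i < m) x i * (q == i)%:R.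
Proof.
case: (ltnP q m) => [qm|mq].
  rewrite (ext_lt _ qm) (bigD1 (Ordinal qm)) //= eqxx mulr1 big1 ?addr0 // => i.
  by rewrite -val_eqE /= eq_sym => /negbTE ->; rewrite mulr0.
rewrite ext_ge // big1 // => i _; rewrite gtn_eqF ?mulr0 //.
exact: leq_trans mq.
Qed.

(** The index set to zero by [Hodd] is [2j+1], the first one at which [ext x] takes its default
    value 0. *)
Lemma Hodd_ext j (x : 'I_(j.*2.+1) -> R) : Hodd j.+1 (ext x) = Hrec (ext x) j.
Proof.
rewrite /Hodd /Heven /=; apply: eq_Hrec => q.
by case: eqP => // ->; rewrite ext_ge.
Qed.

Lemma mxO_single m (A : 'I_m -> 'M[C]_n) i :
  mxO A (fun l => (l == i)%:R) = A i.
Proof.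
rewrite /mxO (bigD1 i) //= eqxx scale1r big1 ?addr0 // => l /negbTE ->.
by rewrite scale0r.
Qed.

Lemma mxOD m (A : 'I_m -> 'M[C]_n) x y :
  mxO A (fun l => x l + y l) = mxO A x + mxO A y.
Proof.
by rewrite /mxO -big_split /=; apply: eq_bigr => l _; rewrite rmorphD scalerDl.
Qed.

Lemma is_HOD_unitary m (A : 'I_m -> 'M[C]_n) i :
  is_HOD A -> A i ^t* *m A i = 1%:M.
Proof.
move/(_ (fun l => (l == i)%:R)); rewrite mxO_single => ->.
rewrite (bigD1 i) //= eqxx expr1n big1 ?addr0 // => l /negbTE ->.
by rewrite expr0n.
Qed.

(** Polarisation: at the sum of two unit vectors the design identity leaves only the cross terms,
    once the two unitarity relations are removed. *)
Lemma is_HOD_orth m (A : 'I_m -> 'M[C]_n) i l :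
  is_HOD A -> i != l -> A i ^t* *m A l = - (A l ^t* *m A i).
Proof.
move=> hA il; have := hA (fun q => (q == i)%:R + (q == l)%:R).
rewrite mxOD !mxO_single trmxCD mulmxDl !mulmxDr !is_HOD_unitary //.
have -> : \sum_(q < m) ((q == i)%:R + (q == l)%:R) ^+ 2 = 1 + 1 :> R.
  rewrite (bigD1 i) //= (bigD1 l) 1?eq_sym //= !eqxx [l == i]eq_sym (negbTE il).
  rewrite addr0 add0r expr1n big1 ?addr0 // => q /andP[/negbTE -> /negbTE ->].
  by rewrite addr0 expr0n.
rewrite rmorphD raddfD /= -addrA => /addrI; rewrite addrA -{2}[1%:M]add0r.
by move=> /addIr/eqP; rewrite addr_eq0 => /eqP.
Qed.

Lemma Hrec_HOD_exists j : (2 ^ j %| n)%N ->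
  exists A : 'I_(j.*2.+1) -> 'M[C]_n, is_HOD A.
Proof.
case/dvdnP=> d dn; have e : (\sum_(l < d) 2 ^ j)%N = n.
  by rewrite sum_nat_const card_ord dn.
(* The coefficients of [d] diagonal copies of [Hrec] are its values at unit vectors; the variable of
   index [2j+1] stays 0. *)
exists (fun i : 'I_(j.*2.+1) =>
  castmx (e, e) (\mxdiag_(l < d) Hrec (fun q => (q == i)%:R) j)).
move=> x; set M := mxO _ x.
have -> : M = castmx (e, e) (\mxdiag_(l < d) Hrec (ext x) j).
  rewrite (eq_Hrec _ (ext_sum x)) Hrec_sum /M /mxO.
  by rewrite mxdiag_sumZ castmx_sumZ.
rewrite trmxC_cast /= trmxC_mxdiag castmx_mul mxdiag_mul (Hrec_hod _ _).1.
rewrite mxdiagZ castmx_scalar big_ord_recr /= ext_ge // expr0n addr0.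
by congr (real_complex _ _)%:M; apply: eq_bigr => i _; rewrite ext_ord.
Qed.

Lemma HOD_decomp j (A : 'I_(j.*2.+1) -> 'M[C]_n) : is_HOD A ->
  exists (d : nat) (e : (\sum_(l < d) 2 ^ j)%N = n) (U V : 'M[C]_n),
    [/\ U \is unitarymx, V \is unitarymx &
      forall x, mxO A x
        = U *m castmx (e, e) (\mxdiag_(l < d) Hrec (ext x) j) *m V].
Proof.
move=> hA; pose A' q := if @insub nat (fun q => q < j.*2.+1)%N 'I_(j.*2.+1) q
  is Some o then A o else 0.
have A'E q (qm : (q < j.*2.+1)%N) : A' q = A (Ordinal qm) by rewrite /A' insubT.
have hA' : hod_family j.*2.+1 A'.
  split=> [i im|i l im lm il]; rewrite !A'E.
    exact: is_HOD_unitary.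
  by apply: is_HOD_orth => //.
have [X hX cX] := hod_family_extend hA'.
have [d [U [V [dn UU VV UHV]]]] := Hrec_decomp_hod hX cX.
have e : (\sum_(l < d) 2 ^ j)%N = n by rewrite sum_nat_const card_ord dn.
(* The completeness relations say [U U^H = 1] and [V^H V = 1] for the assembled matrices, which are
   square by [e], hence unitary. *)
exists d, e, (castmx (erefl, e) (\mxrow_l U l)), (castmx (e, erefl) (\mxcol_l V l)).
split.
- apply/unitarymxP; rewrite trmxC_cast mulmx_cast2 trmxC_mxrow.
  by rewrite mul_mxrow_mxcol.
- apply/unitarymxP; apply: mulmx1C; rewrite trmxC_cast mulmx_cast2 trmxC_mxcol.
  by rewrite mul_mxrow_mxcol.
move=> x; rewrite mulmx_cast3 mul_mxrow_mxdiag mul_mxrow_mxcol -UHV.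
(* The auxiliary matrix [X] has coefficient [ext x] at [2j+1], which is 0, so the sum reduces to the
   original design. *)
rewrite big_ord_recr /= ext_ge // scale0r addr0; apply: eq_bigr => i _.
by rewrite ext_ord ltn_eqF //= A'E; congr (_ *: A _); apply: val_inj.
Qed.

End HOD.

Theorem theorem3 (R : realType) (n k : nat) :
  (0 < n)%N -> (0 < k)%N ->
  ((exists A : 'I_(k.*2.-1) -> 'M[R[i]]_n, is_HOD A) <-> (2 ^ k.-1 %| n)%N) /\
  (forall A : 'I_(k.*2.-1) -> 'M[R[i]]_n, is_HOD A ->
     exists (d : nat) (e : (\sum_(j < d) 2 ^ k.-1)%N = n) (U V : 'M[R[i]]_n),
       [/\ U \is unitarymx, V \is unitarymx &
         forall x : 'I_(k.*2.-1) -> R,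
           mxO A x = U *m castmx (e, e) (\mxdiag_(j < d) Hodd k (ext x)) *m V]).
Proof.
move=> _; case: k => [//|k] _; split; first split.
- case=> A /HOD_decomp[d [e _]].
  by rewrite -e sum_nat_const card_ord dvdn_mull.
- exact: Hrec_HOD_exists.
move=> A /HOD_decomp[d [e [U [V [hU hV hx]]]]].
exists d, e, U, V; split=> // x; rewrite hx.
by rewrite (Hodd_ext x).
Qed.
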